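(* Let $g\in\mathbb K[S,S^{-1}]$, $\lambda\in\mathbb K$, and let $H=2(X+g)D-\lambda$, $E=(X+g)^2D-\lambda(X+g)$ in $\mathcal A$. If $g=0$, then $$\nu_-(H)=-1,\quad \nu_+(H)=0,\qquad \nu_-(E)=-2,\quad \nu_+(E)=-1.$$ Suppose $g\neq0$ and write $g(S)=\sum_{j=p}^{q}c_jS^j$ with $c_j\in\mathbb K$ and $c_pc_q\neq0$. Then $$\nu_-(H)=\min\{-1,p\},\qquad \nu_+(H)=\max\{0,q+1\},$$ and $$\nu_-(E)=\min\{-2,2p\},\qquad \nu_+(E)=\max\{-1,2q+1\}.$$ In particular, these endpoints are independent of $\lambda$, and there are no exceptional coefficient loci on which an extreme shift disappears.
   Context: $\mathbb K$ is a field of characteristic zero. $\mathcal A=\mathbb K[x]\langle S,S^{-1}\rangle/(Sx-(x+1)S)$; its elements are uniquely finite sums $\sum_j t_j(x)S^j$ with $j\in\mathbb Z$, $t_j(x)\in\mathbb K[x]$. Set $D=S-1$ and $X=xS^{-1}$. (The triples $(E,H,1-S)$ with $E,H$ as in the claim are exactly the $\mathfrak{sl}_2$-triples in $\mathcal A$ with lowering operator $F=1-S$, each for a unique pair $(g,\lambda)$.) For a nonzero operator $T=\sum_{j=a}^{b}t_j(x)S^j\in\mathcal A$ with $t_a\ne0$ and $t_b\neq0$, put $\nu_-(T)=a$ and $\nu_+(T)=b$. *)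

(* Defs.v *)
From HB Require Import structures.
From mathcomp Require Import all_boot all_order all_algebra finmap.
From mathcomp Require Import monalg.

Set Implicit Arguments.
Unset Strict Implicit.
Unset Printing Implicit Defensive.

Import Order.TTheory GRing.Theory Num.Theory.
Local Open Scope ring_scope.

(* The algebra K[x]<S, S^-1> / (S x - (x + 1) S), built on its normal forms:
   T : shiftAlg K stands for the finite sum \sum_j T@_j(x) S^j. *)
Definition shiftAlg (K : fieldType) := {malg {poly K}[int]}.

(* S^j p(x) = p(x + j) S^j *)
Definition xshift (K : fieldType) (j : int) (p : {poly K}) : {poly K} :=
  p \Po ('X + (j%:~R)%:P).

Section ShiftAlg.
Variable K : fieldType.
Local Notation A := (shiftAlg K).
Implicit Types (T U V : A) (p q : {poly K}) (i j k : int).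

HB.instance Definition _ := GRing.Zmodule.on A.

Definition smul T U : A :=
  \sum_(j <- msupp T) \sum_(k <- msupp U)
     << T@_j * xshift j U@_k *g j + k >>.

Definition sone : A := << 1 *g 0 >>.

(* K acts through the constants of K[x]; the action of {poly K} on
   {malg {poly K}[int]} is not inherited by shiftAlg K. *)
Definition sscale (a : K) T : A := (a%:P : {poly K}) *: (T : {malg {poly K}[int]}).

Lemma xshift_additive j : additive (@xshift K j).
Proof. by move=> p q; rewrite /xshift comp_polyB. Qed.
HB.instance Definition _ j :=
  GRing.isAdditive.Build {poly K} {poly K} (@xshift K j) (xshift_additive j).

Lemma xshiftM j p q : xshift j (p * q) = xshift j p * xshift j q.
Proof. by rewrite /xshift comp_polyM. Qed.

Lemma xshiftC j (a : K) : xshift j a%:P = a%:P.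
Proof. by rewrite /xshift comp_polyC. Qed.

Lemma xshift0 p : xshift 0 p = p.
Proof. by rewrite /xshift mulr0z addr0 comp_polyXr. Qed.

Lemma xshiftD i j p : xshift i (xshift j p) = xshift (i + j) p.
Proof.
rewrite /xshift -comp_polyA comp_polyD comp_polyX comp_polyC -addrA -polyCD.
by rewrite intrD.
Qed.

Lemma smulEw (d1 d2 : {fset int}) T U :
  (msupp T `<=` d1)%fset -> (msupp U `<=` d2)%fset ->
  smul T U = \sum_(j <- d1) \sum_(k <- d2) << T@_j * xshift j U@_k *g j + k >>.
Proof.
move=> s1 s2; rewrite /smul (big_fset_incl _ s1) /=; last first.
  move=> j _ /mcoeff_outdom ->; apply: big1 => k _.
  by rewrite mul0r monalgU0.
apply: eq_bigr => j _; rewrite (big_fset_incl _ s2) // => k _ /mcoeff_outdom ->.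
by rewrite raddf0 mulr0 monalgU0.
Qed.

Lemma smulDl : left_distributive smul +%R.
Proof.
move=> T U V; pose d := (msupp T `|` msupp U)%fset.
rewrite (@smulEw d (msupp V)) ?msuppD_le //.
rewrite (@smulEw d (msupp V) T) ?fsubsetUl //.
rewrite (@smulEw d (msupp V) U) ?fsubsetUr //.
rewrite -big_split; apply: eq_bigr => j _; rewrite -big_split.
by apply: eq_bigr => k _ /=; rewrite mcoeffD mulrDl raddfD.
Qed.

Lemma smulDr : right_distributive smul +%R.
Proof.
move=> V T U; pose d := (msupp T `|` msupp U)%fset.
rewrite (@smulEw (msupp V) d) ?msuppD_le //.
rewrite (@smulEw (msupp V) d V T) ?fsubsetUl //.
rewrite (@smulEw (msupp V) d V U) ?fsubsetUr //.
rewrite -big_split; apply: eq_bigr => j _; rewrite -big_split.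
by apply: eq_bigr => k _ /=; rewrite mcoeffD raddfD mulrDr raddfD.
Qed.

Lemma smul0l T : smul 0 T = 0.
Proof. by apply: (addrI (smul 0 T)); rewrite -smulDl !addr0. Qed.

Lemma smul0r T : smul T 0 = 0.
Proof. by apply: (addrI (smul T 0)); rewrite -smulDr !addr0. Qed.

Lemma smul_suml I (r : seq I) (F : I -> A) T :
  smul (\sum_(i <- r) F i) T = \sum_(i <- r) smul (F i) T.
Proof. exact: (big_morph (smul^~ T) (fun x y => smulDl x y T) (smul0l T)). Qed.

Lemma smul_sumr I (r : seq I) (F : I -> A) T :
  smul T (\sum_(i <- r) F i) = \sum_(i <- r) smul T (F i).
Proof. exact: (big_morph (smul T) (smulDr T) (smul0r T)). Qed.

Lemma smulUU p q j k :
  smul << p *g j >> << q *g k >> = << p * xshift j q *g j + k >>.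
Proof.
rewrite (smulEw (@msuppU_le _ _ _ _) (@msuppU_le _ _ _ _)).
by rewrite !big_seq_fset1 !mcoeffUU.
Qed.

Lemma malg_ind (P : A -> Prop) :
    P 0 -> (forall T U, P T -> P U -> P (T + U)) ->
    (forall p j, P << p *g j >>) ->
  forall T, P T.
Proof. by move=> P0 PD PU T; rewrite [T]monalgE; elim/big_ind: _. Qed.

Lemma smulA : associative smul.
Proof.
move=> T U V; elim/malg_ind: T => [|T1 T2 h1 h2|p i].
- by rewrite !smul0l.
- by rewrite !smulDl h1 h2.
elim/malg_ind: U => [|U1 U2 h1 h2|q j].
- by rewrite smul0l smul0r smul0l.
- by rewrite smulDl !smulDr smulDl h1 h2.
elim/malg_ind: V => [|V1 V2 h1 h2|r k].
- by rewrite !smul0r.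
- by rewrite !smulDr h1 h2.
by rewrite !smulUU xshiftM xshiftD mulrA addrA.
Qed.

Lemma smul1l : left_id sone smul.
Proof.
elim/malg_ind => [|T1 T2 h1 h2|p i]; first exact: smul0r.
- by rewrite smulDr h1 h2.
by rewrite smulUU mul1r xshift0 add0r.
Qed.

Lemma smul1r : right_id sone smul.
Proof.
elim/malg_ind => [|T1 T2 h1 h2|p i]; first exact: smul0l.
- by rewrite smulDl h1 h2.
by rewrite smulUU xshiftC mulr1 addr0.
Qed.

Lemma sone_neq0 : sone != 0.
Proof. by rewrite monalgU_eq0 oner_eq0. Qed.

HB.instance Definition _ :=
  GRing.Zmodule_isNzRing.Build A smulA smul1l smul1r smulDl smulDr sone_neq0.

Lemma sscaleA a b T : sscale a (sscale b T) = sscale (a * b) T.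
Proof. by rewrite /sscale scalerA polyCM. Qed.

Lemma sscale1r : left_id 1 sscale.
Proof. by move=> T; rewrite /sscale scale1r. Qed.

Lemma sscaleDr : right_distributive sscale +%R.
Proof. by move=> a T U; rewrite /sscale; exact: scalerDr. Qed.

Lemma sscaleDl T : {morph sscale^~ T : a b / a + b}.
Proof. by move=> a b; rewrite /sscale polyCD scalerDl. Qed.

HB.instance Definition _ :=
  GRing.Zmodule_isLmodule.Build K A sscaleA sscale1r sscaleDr sscaleDl.

Lemma sscaleU a p j : a *: (<< p *g j >> : A) = << a%:P * p *g j >>.
Proof.
by apply/malgP => k; rewrite [LHS]mcoeffZ !mcoeffU mulrnAr.
Qed.

Lemma sscaleAl a T U : a *: (T * U) = (a *: T) * U.
Proof.
elim/malg_ind: T => [|T1 T2 h1 h2|p i].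
- by rewrite mul0r !scaler0 mul0r.
- by rewrite mulrDl !scalerDr mulrDl h1 h2.
elim/malg_ind: U => [|U1 U2 h1 h2|q j].
- by rewrite !mulr0 scaler0.
- by rewrite !mulrDr scalerDr h1 h2.
by rewrite sscaleU /GRing.mul /= !smulUU sscaleU mulrA.
Qed.

HB.instance Definition _ := GRing.Lmodule_isLalgebra.Build K A sscaleAl.

Lemma sscaleAr a T U : a *: (T * U) = T * (a *: U).
Proof.
elim/malg_ind: T => [|T1 T2 h1 h2|p i].
- by rewrite !mul0r scaler0.
- by rewrite !mulrDl scalerDr h1 h2.
elim/malg_ind: U => [|U1 U2 h1 h2|q j].
- by rewrite mulr0 !scaler0 mulr0.
- by rewrite mulrDr !scalerDr mulrDr h1 h2.
by rewrite sscaleU /GRing.mul /= !smulUU sscaleU xshiftM xshiftC mulrCA.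
Qed.

HB.instance Definition _ := GRing.Lalgebra_isAlgebra.Build K A sscaleAr.

End ShiftAlg.

Section Operators.
Variable K : fieldType.
Local Notation A := (shiftAlg K).
Implicit Types (g T : A) (lambda : K).

Definition opx : A := << 'X *g 0 >>.
Definition opS (j : int) : A := << 1 *g j >>.

Definition opD : A := opS 1 - 1.
Definition opX : A := opx * opS (-1).

Definition opH g lambda : A := 2 * (opX + g) * opD - lambda%:A.
Definition opE g lambda : A := (opX + g) ^+ 2 * opD - lambda *: (opX + g).

(* the subalgebra K[S, S^-1], as the K-span of the powers of S *)
Definition laurentS g : Prop :=
  exists (r : seq int) (c : int -> K), g = \sum_(j <- r) c j *: opS j.

(* \sum_(j = p)^q c_j S^j; meant for p <= q *)
Definition laurent_sum (p q : int) (c : int -> K) : A :=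
  \sum_(0 <= k < `|q - p|.+1) c (p + k%:Z) *: opS (p + k%:Z).

(* Least and greatest exponent of S occurring in T; both are 0 if T = 0. *)
Definition nu_minus T : int := head 0 (sort <=%O (msupp T)).
Definition nu_plus T : int := last 0 (sort <=%O (msupp T)).

End Operators.

Arguments opx {K}.
Arguments opS {K} j.
Arguments opD {K}.
Arguments opX {K}.

Section Facts.
Variable K : fieldType.
Local Notation A := (shiftAlg K).

Lemma opS0 : opS 0 = 1 :> A. Proof. by []. Qed.

Lemma opSD i j : opS (i + j) = opS i * opS j :> A.
Proof. by rewrite /GRing.mul /= smulUU xshiftC mulr1. Qed.

Lemma opS_x : opS 1 * opx = (opx + 1) * opS 1 :> A.
Proof.
rewrite -opS0 /opS /opx -monalgUD /GRing.mul /= !smulUU xshiftC mul1r mulr1.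
by rewrite addr0 add0r /xshift comp_polyX.
Qed.

Lemma horner_opx (p : {poly K}) : horner_alg (opx : A) p = << p *g 0 >>.
Proof.
elim/poly_ind: p => [|p c IHp]; first by rewrite rmorph0 monalgU0.
rewrite rmorphD rmorphM /= horner_algX horner_algC IHp raddfD /=; congr (_ + _).
  by rewrite /GRing.mul /= smulUU xshift0 addr0.
by rewrite -opS0 sscaleU mulr1.
Qed.

Lemma opxU (p : {poly K}) j :
  horner_alg (opx : A) p * opS j = << p *g j >>.
Proof.
by rewrite horner_opx /GRing.mul /= smulUU xshiftC mulr1 add0r.
Qed.

Lemma shiftAlgE (T : A) :
  T = \sum_(j <- msupp T) horner_alg opx T@_j * opS j.
Proof. by rewrite {1}[T]monalgE; apply: eq_bigr => j _; rewrite opxU. Qed.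

(* shiftAlg K is the algebra presented by x, S, S^-1 and S x = (x + 1) S. *)
Section Presentation.
Variables (B : algType K) (x s s' : B).
Hypotheses (ss' : s * s' = 1) (s's : s' * s = 1) (sx : s * x = (x + 1) * s).

Local Notation h := (horner_alg x).

Let sp (j : int) : B :=
  match j with Posz n => s ^+ n | Negz n => s' ^+ n.+1 end.

Let spS j : sp (j + 1) = sp j * s.
Proof.
case: j => [n|[|n]]; first by rewrite -[1]/(Posz 1) -PoszD addn1 /= exprSr.
  by rewrite /= expr1 s's.
have -> : Negz n.+1 + 1 = Negz n by rewrite !NegzE -addn1 PoszD opprD addrNK.
by rewrite /= [s' ^+ n.+2]exprSr -mulrA s's mulr1.
Qed.

Let spP j : sp (j - 1) = sp j * s'.
Proof. by rewrite -{2}[j](subrK 1) spS -mulrA ss' mulr1. Qed.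

Let spD i j : sp (i + j) = sp i * sp j.
Proof.
elim/int_ind: j => [|n IHn|n IHn]; first by rewrite addr0 mulr1.
  by rewrite -addn1 PoszD addrA !spS IHn mulrA.
by rewrite -addn1 PoszD opprD addrA !spP IHn mulrA.
Qed.

Let sh p : s * h p = h (xshift 1 p) * s.
Proof.
elim/poly_ind: p => [|p c IHp]; first by rewrite !raddf0 mulr0 mul0r.
rewrite /xshift comp_polyD comp_polyM comp_polyX comp_polyC.
rewrite !(rmorphD, rmorphM) /= !horner_algX !horner_algC mulrDr mulrA IHp.
rewrite -mulrA sx [RHS]mulrDl mulr1z scale1r !mulrA; congr (_ + _).
by rewrite -scalerAl -scalerAr mul1r mulr1.
Qed.

Let s'h p : s' * h p = h (xshift (-1) p) * s'.
Proof.
have := sh (xshift (-1) p); rewrite xshiftD subrr xshift0 => e.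
have -> : s' * h p = s' * (h p * s) * s' by rewrite -!mulrA ss' mulr1.
by rewrite -e mulrA s's mul1r.
Qed.

Let sph j p : sp j * h p = h (xshift j p) * sp j.
Proof.
elim/int_ind: j p => [|n IHn|n IHn] p; first by rewrite mul1r mulr1 xshift0.
  by rewrite -addn1 PoszD spS -mulrA sh mulrA IHn xshiftD mulrA.
by rewrite -addn1 PoszD opprD spP -mulrA s'h mulrA IHn xshiftD mulrA.
Qed.

Let ev (T : A) : B := \sum_(j <- msupp T) h T@_j * sp j.

Let evw (d : {fset int}) T :
  (msupp T `<=` d)%fset -> ev T = \sum_(j <- d) h T@_j * sp j.
Proof.
move=> sd; rewrite /ev (big_fset_incl _ sd) //= => j _ /mcoeff_outdom ->.
by rewrite rmorph0 mul0r.
Qed.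

Let evU p j : ev << p *g j >> = h p * sp j.
Proof. by rewrite (evw msuppU_le) big_seq_fset1 mcoeffUU. Qed.

Let ev_lin : linear ev.
Proof.
move=> a T U; pose d := (msupp T `|` msupp U)%fset.
have hZ j : (a *: T)@_j = a%:P * T@_j by rewrite [LHS]mcoeffZ.
rewrite (@evw d T) ?fsubsetUl // (@evw d U) ?fsubsetUr // (@evw d); last first.
  apply: (fsubset_trans (msuppD_le _ _)); apply: fsetSU.
  exact: (@msuppZ_le int {poly K} a%:P).
rewrite scaler_sumr -big_split; apply: eq_bigr => j _ /=.
by rewrite mcoeffD hZ rmorphD rmorphM /= horner_algC mulr_algl mulrDl scalerAl.
Qed.

HB.instance Definition _ := GRing.isLinear.Build K A B *:%R ev ev_lin.

Let ev_mult : multiplicative ev.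
Proof.
split; last by rewrite evU rmorph1 mulr1.
move=> T U; elim/malg_ind: T => [|T1 T2 h1 h2|p i].
- by rewrite mul0r raddf0 mul0r.
- by rewrite mulrDl !raddfD /= h1 h2 mulrDl.
elim/malg_ind: U => [|U1 U2 h1 h2|q j].
- by rewrite mulr0 raddf0 mulr0.
- by rewrite mulrDr !raddfD /= h1 h2 mulrDr.
rewrite [X in ev X]/GRing.mul /= smulUU !evU rmorphM spD /= -!mulrA; congr (_ * _).
by rewrite !mulrA sph.
Qed.

HB.instance Definition _ := GRing.isMultiplicative.Build A B ev ev_mult.

Lemma shiftAlg_presentation :
  exists f : {lrmorphism A -> B},
    [/\ f opx = x, f (opS 1) = s &
        forall f' : {lrmorphism A -> B}, f' opx = x -> f' (opS 1) = s -> f' =1 f].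
Proof.
exists ev; split; first by rewrite /= evU mulr1 horner_algX.
  by rewrite /= evU rmorph1 mul1r.
move=> f fx fS T; rewrite [T]shiftAlgE !raddf_sum /=; apply: eq_bigr => j _.
have fh p : f (horner_alg opx p) = h p.
  elim/poly_ind: p => [|p c IHp]; first by rewrite !rmorph0.
  rewrite !(rmorphD, rmorphM) /= !horner_algX !horner_algC IHp fx.
  by rewrite linearZ rmorph1.
have fN : f (opS (-1)) = s'.
  rewrite -[LHS]mulr1 -ss' mulrA -fS -rmorphM -opSD addNr rmorph1.
  by rewrite mul1r.
have fSj i : f (opS i) = sp i.
  elim/int_ind: i => [|n IHn|n IHn]; first exact: rmorph1.
    by rewrite -addn1 PoszD opSD rmorphM spS /= IHn fS.
  by rewrite -addn1 PoszD opprD opSD rmorphM spP /= IHn fN.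
by rewrite rmorphM /= fh fSj opxU evU.
Qed.

End Presentation.

Lemma msupp_neq0 (T : A) : T != 0 -> exists j, j \in msupp T.
Proof.
move=> T0; have [e|[j]] := fset_0Vmem (msupp T); last by exists j.
case/eqP: T0; rewrite [T]monalgE e; exact: big_seq_fset0.
Qed.

Lemma nu_minusP (T : A) : T != 0 ->
  T@_(nu_minus T) != 0 /\ forall j, T@_j != 0 -> nu_minus T <= j.
Proof.
move=> /msupp_neq0 [i iT]; rewrite /nu_minus mcoeff_neq0.
have := sort_le_sorted (msupp T); have := mem_sort <=%O (msupp T).
case: sort => [|k s] hm /=; first by rewrite -hm in iT.
rewrite -hm mem_head => hs; split=> // j; rewrite mcoeff_neq0 -hm inE.
by case/predU1P => [->//|js]; move/(order_path_min le_trans)/allP: hs; apply.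
Qed.

Lemma nu_plusP (T : A) : T != 0 ->
  T@_(nu_plus T) != 0 /\ forall j, T@_j != 0 -> j <= nu_plus T.
Proof.
move=> /msupp_neq0 [i iT]; rewrite /nu_plus mcoeff_neq0.
have := sort_le_sorted (msupp T); have := mem_sort <=%O (msupp T).
case: (lastP (sort _ _)) => [|s k] hm; first by rewrite -hm in iT.
rewrite last_rcons -hm mem_rcons mem_head => hs; split=> // j.
rewrite mcoeff_neq0 -hm mem_rcons inE => /predU1P [->//|js].
move: hs; rewrite -cats1 (sorted_pairwise le_trans) pairwise_cat allrel1r.
by case/and3P => /allP/(_ j js).
Qed.

End Facts.

(* Main.v *)
(* The product of the extreme coefficients t_a(x) and u_b(x + a) never vanishes,
   so nu_- and nu_+ are additive on products.  With G = X + g one has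
   H = 2 G D - lambda and E = G (G D - lambda), so everything reduces to the
   endpoints of G and of k G D - lambda.  The coefficient of S^-1 in G is
   x + const, hence it can be cancelled by no scalar. *)
Require Import Defs.
From HB Require Import structures.
From mathcomp Require Import all_boot all_order all_algebra finmap.
From mathcomp Require Import monalg.
From mathcomp Require Import zify.

Set Implicit Arguments.
Unset Strict Implicit.
Unset Printing Implicit Defensive.

Import Order.TTheory GRing.Theory Num.Theory.
Local Open Scope ring_scope.

Section Endpoints.
Variable K : fieldType.
Local Notation A := (shiftAlg K).
Implicit Types (g G T U : A) (p : {poly K}) (a b i j s : int) (lambda k z : K).

(** * Coefficients of products *)

Lemma xshift_eq0 j p : (xshift j p == 0) = (p == 0).
Proof.
apply/eqP/eqP => [h|->]; last exact: raddf0.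
by rewrite -[p]xshift0 -(addNr j) -xshiftD h raddf0.
Qed.

(** Since S^j u(x) = u(x + j) S^j, exponent j of T pairs with i - j in U. Induction on U alone keeps
    the range [msupp T] fixed. *)
Lemma mcoeff_smul T U i :
  (T * U)@_i = \sum_(j <- msupp T) T@_j * xshift j U@_(i - j).
Proof.
elim/malg_ind: U => [|U1 U2 h1 h2|p k].
- rewrite mulr0 mcoeff0 big1 // => j _; by rewrite mcoeff0 raddf0 mulr0.
- rewrite mulrDr mcoeffD h1 h2 -big_split; apply: eq_bigr => j _ /=.
  by rewrite mcoeffD raddfD mulrDr.
rewrite /GRing.mul /= (smulEw (fsubset_refl _) (@msuppU_le _ _ _ _)).
rewrite raddf_sum /=; apply: eq_bigr => j _.
rewrite big_seq_fset1 mcoeffUU !mcoeffU raddfMn -mulrnAr /=; congr (_ * (_ *+ _)).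
by rewrite addrC eq_sym [k == _]eq_sym subr_eq eq_sym.
Qed.

Lemma mcoeff_smulS T i : (T * opS 1)@_i = T@_(i - 1).
Proof.
elim/malg_ind: T => [|T1 T2 h1 h2|p k].
- by rewrite mul0r !mcoeff0.
- by rewrite mulrDl !mcoeffD h1 h2.
rewrite /GRing.mul /= smulUU xshiftC mulr1 !mcoeffU.
by rewrite [k == _]eq_sym subr_eq eq_sym.
Qed.

Lemma mcoeff_sscale k T i : (k *: T)@_i = k%:P * T@_i.
Proof. by rewrite [LHS]mcoeffZ. Qed.

Lemma mcoeff_sscale1 k i : (k%:A : A)@_i = if i == 0 then k%:P else 0.
Proof.
rewrite mcoeff_sscale mcoeffU eq_sym; case: eqP => _.
  by rewrite mulr1.
by rewrite mulr0.
Qed.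

(* For s = 1 the index a is nu_minus T, for s = -1 it is nu_plus T. *)
Definition extreme s T a : Prop :=
  T@_a != 0 /\ forall j, T@_j != 0 -> s * a <= s * j.

Lemma extreme_neq0 s T a : extreme s T a -> T != 0.
Proof. by case=> Ta _; apply: contraNneq Ta => ->; rewrite mcoeff0. Qed.

Lemma extreme_nu_minus T : T != 0 -> extreme 1 T (nu_minus T).
Proof. by case/nu_minusP=> ? h; split=> // j; rewrite !mul1r; exact: h. Qed.

Lemma extreme_nu_plus T : T != 0 -> extreme (-1) T (nu_plus T).
Proof.
by case/nu_plusP=> ? h; split=> // j; rewrite !mulN1r lerN2; exact: h.
Qed.

Lemma extreme_inj s T a b : s != 0 -> extreme s T a -> extreme s T b -> a = b.
Proof.
move=> s0 [Ta ha] [Tb hb]; apply: (mulfI s0); apply/le_anti.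
by rewrite ha // hb.
Qed.

Lemma nu_minusE T a : extreme 1 T a -> nu_minus T = a.
Proof.
move=> Ta; have hT := extreme_nu_minus (extreme_neq0 Ta).
exact: extreme_inj hT Ta.
Qed.

Lemma nu_plusE T a : extreme (-1) T a -> nu_plus T = a.
Proof.
move=> Ta; have hT := extreme_nu_plus (extreme_neq0 Ta).
exact: extreme_inj hT Ta.
Qed.

(** At a + b only the term j = a survives: any other j in the support of T puts a + b - j strictly
    beyond b. That term is nonzero because [{poly K}] is a domain and shifts are injective. *)
Lemma extreme_mul s T U a b : s != 0 ->
  extreme s T a -> extreme s U b -> extreme s (T * U) (a + b).
Proof.
move=> s0 [Ta ha] [Ub hb]; split=> [|j].
  rewrite mcoeff_smul (bigD1_seq a) ?fset_uniq ?mcoeff_neq0 //=; last first.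
    by rewrite -mcoeff_neq0.
  rewrite big_seq_cond big1 ?addr0 => [|j /andP[]].
    by rewrite addrAC subrr add0r mulf_neq0 // xshift_eq0.
  rewrite -mcoeff_neq0 => Tj ja; apply/eqP; rewrite mulf_eq0 xshift_eq0 orbC.
  (* Distributing s turns s * a, s * b and s * j into atoms of a linear problem for [lia]. *)
  apply/orP; left; apply: contraNT ja => /hb; rewrite mulrBr mulrDr => h.
  apply/eqP/(mulfI s0)/le_anti; rewrite ha // andbT.
  by move: h; lia.
apply: contraNT; rewrite -ltNge mcoeff_smul => h.
apply/eqP; rewrite big_seq big1 // => k; rewrite -mcoeff_neq0 => /ha hk.
apply/eqP; rewrite mulf_eq0 xshift_eq0; apply/orP; right.
apply: contraLR h => /hb; rewrite mulrBr mulrDr -leNgt; lia.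
Qed.

(** * Endpoints of k G D - lambda *)

Section Pencil.
Variables (G : A) (k lambda : K).
Hypotheses (G_nonconst : forall z, G@_(-1) != z%:P) (k0 : k != 0).

Let W : A := k *: (G * opD) - lambda%:A.

Let mcoeffW i :
  W@_i = k%:P * (G@_(i - 1) - G@_i) - (if i == 0 then lambda%:P else 0).
Proof.
by rewrite mcoeffB mcoeff_sscale mcoeff_sscale1 mulrBr mulr1 mcoeffB mcoeff_smulS.
Qed.

Let G0 : G@_(-1) != 0. Proof. exact: G_nonconst. Qed.
Let kP0 : k%:P != 0 :> {poly K}. Proof. by rewrite polyC_eq0. Qed.

(** As [G@_(-1)] is nonzero, a <= -1, so lambda at S^0 is out of reach. At S^a only -k [G@_a] is
    left, because G S starts one step higher. *)
Lemma extreme_pencil_minus a : extreme 1 G a -> extreme 1 W a.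
Proof.
case=> Ga ha; have a1 : a <= -1 by have := ha _ G0; lia.
have z j : j < a -> G@_j = 0.
  by move=> ja; apply/eqP; apply: contraLR ja => /ha; lia.
split=> [|j].
  rewrite mcoeffW [G@_(a - 1)]z ?sub0r; last by lia.
  by rewrite (_ : (a == 0) = false) ?subr0 ?mulf_neq0 ?oppr_eq0 //; lia.
apply: contraNT => ja; rewrite mcoeffW !z; try lia.
by rewrite (_ : (j == 0) = false) ?subr0 ?mulr0 //; lia.
Qed.

(* The constant lambda could only meet the top coefficient at S^0, and there
   the coefficient of k G D is not a constant polynomial. *)
Lemma extreme_pencil_plus b : extreme (-1) G b -> extreme (-1) W (b + 1).
Proof.
case=> Gb hb; have b1 : -1 <= b by have := hb _ G0; lia.
have z j : b < j -> G@_j = 0.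
  by move=> ja; apply/eqP; apply: contraLR ja => /hb; lia.
split=> [|j].
  rewrite mcoeffW addrK [G@_(b + 1)]z ?subr0; last by lia.
  case: (b + 1 =P 0) => [e|_]; last by rewrite subr0 mulf_neq0.
  have -> : b = -1 by lia.
  rewrite subr_eq0; apply/eqP => h.
  (* If k [G@_(-1)] were lambda, [G@_(-1)] would be the constant lambda / k. *)
  have /eqP[] := G_nonconst (k^-1 * lambda).
  by apply: (mulfI kP0); rewrite h -polyCM mulrA divff // mul1r.
apply: contraNT => ja; rewrite mcoeffW !z; try lia.
by rewrite (_ : (j == 0) = false) ?subr0 ?mulr0 //; lia.
Qed.

End Pencil.

Lemma opH_pencil g lambda :
  opH g lambda = 2%:R *: ((opX + g) * opD) - lambda%:A.
Proof. by rewrite /opH -mulrA mulr_natl scaler_nat. Qed.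

(** The scalar 1 gives the second factor the pencil form with k = 1, so that [extreme_mul] applies
    to E. *)
Lemma opE_pencil g lambda :
  opE g lambda = (opX + g) * (1 *: ((opX + g) * opD) - lambda%:A).
Proof. by rewrite /opE scale1r [RHS]mulrBr mulrA -expr2 mulr_algr. Qed.

Lemma mcoeff_opX i : (opX : A)@_i = if i == -1 then 'X else 0.
Proof.
rewrite /opX /GRing.mul /= smulUU xshift0 mulr1 add0r mcoeffU eq_sym.
by case: eqP.
Qed.

Lemma mcoeff_sum_opS (r : seq int) (c : int -> K) i :
  (\sum_(j <- r) c j *: opS j : A)@_i = (\sum_(j <- r | j == i) c j)%:P.
Proof.
rewrite !raddf_sum /= [RHS]big_mkcond; apply: eq_bigr => j _ /=.
by rewrite mcoeff_sscale mcoeffU; case: eqP => _; rewrite ?mulr1 ?mulr0.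
Qed.

Lemma laurentS_const g i : laurentS g -> exists z, g@_i = z%:P.
Proof. by case=> r [c ->]; rewrite mcoeff_sum_opS //; eexists. Qed.

Lemma mcoeff_laurent_sum (p q : int) (c : int -> K) i : p <= q ->
  (laurent_sum p q c)@_i = if p <= i <= q then (c i)%:P else 0.
Proof.
move=> pq; rewrite /laurent_sum raddf_sum /=.
under eq_bigr => j _ do rewrite mcoeff_sscale mcoeffU.
case: ifP => [/andP[pi iq]|ni]; last first.
  rewrite big_nat big1 // => j /andP[_ hj].
  by rewrite (_ : (_ == _) = false) ?mulr0 //; move: hj ni; lia.
(* The summation index is natural; as p <= i, the one with exponent i is the absolute value of i -
   p. *)
have e : p + `|i - p|%N%:Z = i by lia.
rewrite (bigD1_seq `|i - p|%N) ?iota_uniq //=; last by rewrite mem_index_iota; lia.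
rewrite e eqxx mulr1 big1 ?addr0 // => j jn.
by rewrite (_ : (_ == _) = false) ?mulr0 //; move: jn; lia.
Qed.

Lemma opXD_nonconst g : laurentS g -> forall z, (opX + g)@_(-1) != z%:P.
Proof.
move=> hg z; have [w e] := laurentS_const (-1) hg.
rewrite mcoeffD mcoeff_opX eqxx e -subr_eq0 -addrA -polyCB.
by rewrite -size_poly_eq0 size_XaddC.
Qed.

(** X + g agrees with g away from S^-1 and never vanishes at S^-1, so its extreme exponent is the
    outermost among -1 and the exponents of g. The disjunction also covers g = 0. *)
Lemma extreme_opXD s g a : laurentS g -> s * a <= s * -1 ->
    (forall j, g@_j != 0 -> s * a <= s * j) -> a = -1 \/ g@_a != 0 ->
  extreme s (opX + g) a.
Proof.
move=> hg a1 ga ha; split=> [|j].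
  have [-> |na] := eqVneq a (-1); first exact: opXD_nonconst.
  by case: ha => [e|]; [rewrite e eqxx in na|rewrite mcoeffD mcoeff_opX (negPf na) add0r].
rewrite mcoeffD mcoeff_opX; case: (j =P -1) => [->//|_]; rewrite add0r; exact: ga.
Qed.

(** The factor D keeps the lower end and raises the upper one by 1; the extra left factor of E adds
    a and b once more. Nonvanishing is recorded because [nu_minus] and [nu_plus] return 0 on the
    zero operator. *)
Lemma endpoints g lambda a b : [pchar K] =i pred0 -> laurentS g ->
    extreme 1 (opX + g) a -> extreme (-1) (opX + g) b ->
  [/\ opH g lambda != 0 /\ opE g lambda != 0,
      nu_minus (opH g lambda) = a, nu_plus (opH g lambda) = b + 1,
      nu_minus (opE g lambda) = a + a & nu_plus (opE g lambda) = b + (b + 1)].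
Proof.
move=> charK hg ha hb; have nc := opXD_nonconst hg.
(* Characteristic zero makes H a pencil with nonzero k = 2. *)
have two0 : 2%:R != 0 :> K by move/pcharf0P: charK => ->.
have Ha := extreme_pencil_minus lambda nc two0 ha.
have Hb := extreme_pencil_plus lambda nc two0 hb.
have Ea := extreme_mul (oner_neq0 _) ha
             (extreme_pencil_minus lambda nc (oner_neq0 _) ha).
have Eb := extreme_mul (isT : -1 != 0 :> int) hb
             (extreme_pencil_plus lambda nc (oner_neq0 _) hb).
rewrite opH_pencil opE_pencil; split.
- by split; [exact: extreme_neq0 Ha | exact: extreme_neq0 Ea].
- exact: nu_minusE.
- exact: nu_plusE.
- exact: nu_minusE.
- exact: nu_plusE.
Qed.

End Endpoints.

Theorem theorem3p1 (K : fieldType) (charK : [pchar K] =i pred0)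
    (g : shiftAlg K) (hg : laurentS g) (lambda : K) :
  (g = 0 ->
     [/\ opH g lambda != 0 /\ opE g lambda != 0,
         nu_minus (opH g lambda) = -1, nu_plus (opH g lambda) = 0,
         nu_minus (opE g lambda) = -2 & nu_plus (opE g lambda) = -1]) /\
  (g != 0 ->
     forall (p q : int) (c : int -> K),
       p <= q -> g = laurent_sum p q c -> c p * c q != 0 ->
     [/\ opH g lambda != 0 /\ opE g lambda != 0,
         nu_minus (opH g lambda) = Num.min (-1) p,
         nu_plus (opH g lambda) = Num.max 0 (q + 1),
         nu_minus (opE g lambda) = Num.min (-2) (2 * p) &
         nu_plus (opE g lambda) = Num.max (-1) (2 * q + 1)]) /\
  (forall mu : K,
     [/\ nu_minus (opH g lambda) = nu_minus (opH g mu),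
         nu_plus (opH g lambda) = nu_plus (opH g mu),
         nu_minus (opE g lambda) = nu_minus (opE g mu) &
         nu_plus (opE g lambda) = nu_plus (opE g mu)]).
Proof.
split=> [g0|]; last split=> [_ p q c pq gE cpq|mu].
- have ext s : extreme s (opX + g) (-1).
    by apply: extreme_opXD => //; [move=> j; rewrite g0 mcoeff0 eqxx | left].
  by have := endpoints lambda charK hg (ext 1) (ext (-1)).
- have gj j : g@_j = if p <= j <= q then (c j)%:P else 0.
    by rewrite gE mcoeff_laurent_sum.
  have [cp cq] : c p != 0 /\ c q != 0 by apply/andP; rewrite -negb_or -mulf_eq0.
  have supp j : g@_j != 0 -> p <= j <= q by rewrite gj; case: ifP; rewrite ?eqxx.
  have gp : g@_p != 0 by rewrite gj lexx pq polyC_eq0.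
  have gq : g@_q != 0 by rewrite gj lexx pq polyC_eq0.
  have ha : extreme 1 (opX + g) (Num.min (-1) p).
    apply: extreme_opXD => //; first by lia.
      by move=> j /supp; lia.
    by case: (leP (-1) p); [left|right].
  (* With b = max(-1, q), the values b + 1 and b + (b + 1) are max(0, q + 1) and max(-1, 2q + 1). *)
  have hb : extreme (-1) (opX + g) (Num.max (-1) q).
    apply: extreme_opXD => //; first by lia.
      by move=> j /supp; lia.
    by case: (leP (-1) q); [right|left].
  move: (endpoints lambda charK hg ha hb).
  (* Otherwise unification compares opH and opE by unfolding them. *)
  move: (opH g lambda) (opE g lambda) => H E [nz -> -> -> ->].
  by split=> //; lia.
(* The endpoints of X + g do not involve the scalar, so the same pair serves lambda and mu without a
   case split on g. *)
have G0 : opX + g != 0.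
  apply: contraNneq (opXD_nonconst hg 0) => ->; by rewrite mcoeff0.
have ha := extreme_nu_minus G0; have hb := extreme_nu_plus G0.
move: (endpoints lambda charK hg ha hb) (endpoints mu charK hg ha hb).
move: (opH g lambda) (opE g lambda) => H E [_ -> -> -> ->].
by move: (opH g mu) (opE g mu) => H' E' [_ -> -> -> ->].
Qed.
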